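(* Let $A,B\in\mathcal{M}_n^+$. If either (i) $A\le B$ and $\frac12\le v\le 1$, or (ii) $A\ge B$ and $0\le v\le\frac12$, then $$A\nabla_v B-A\sharp_v B\;\ge\;\frac{v(1-v)}{2}(B-A)(A\nabla B)^{-1}(B-A).$$
   Context: $\mathcal{M}_n^+$ denotes the set of positive (definite) $n\times n$ complex matrices: $A\in\mathcal{M}_n^+$ iff $\langle Ax,x\rangle>0$ for all nonzero $x\in\mathbb{C}^n$. For Hermitian matrices, $X\le Y$ (equivalently $Y\ge X$) means that $Y-X$ is positive semidefinite. For $A,B\in\mathcal{M}_n^+$ and $0\le v\le1$, $A\nabla_v B=(1-v)A+vB$ is the weighted arithmetic mean, $A\nabla B=\frac{A+B}{2}$, and $A\sharp_v B=A^{1/2}\left(A^{-1/2}BA^{-1/2}\right)^{v}A^{1/2}$ is the weighted geometric mean. *)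

(* Defs.v *)
From mathcomp Require Import all_boot all_order all_algebra.
From mathcomp Require Import complex.
From mathcomp Require Import reals exp.

Set Implicit Arguments.
Unset Strict Implicit.
Unset Printing Implicit Defensive.

Import Order.TTheory GRing.Theory Num.Theory.
Local Open Scope ring_scope.
Local Open Scope complex_scope.
Local Open Scope sesquilinear_scope.

(* The complex numbers are R[i] for R : realType, and vectors are columns.    *)

(* <u, v> = \sum_i u_i (v_i)^*: linear in u, conjugate-linear in v.           *)
Definition cdot (R : realType) (n : nat) (u v : 'cV[R[i]]_n) : R[i] :=
  (v^t* *m u) 0 0.

(* In R[i], 0 < z (resp. 0 <= z) means that z is real and positive (resp.     *)
(* nonnegative), so both predicates below imply that A is Hermitian.          *)
Definition posdef (R : realType) (n : nat) (A : 'M[R[i]]_n) : Prop :=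
  forall x : 'cV[R[i]]_n, x != 0 -> 0 < cdot (A *m x) x.

Definition possemidef (R : realType) (n : nat) (A : 'M[R[i]]_n) : Prop :=
  forall x : 'cV[R[i]]_n, 0 <= cdot (A *m x) x.

Definition loewner_le (R : realType) (n : nat) (X Y : 'M[R[i]]_n) : Prop :=
  possemidef (Y - X).

(* Functional calculus: a Hermitian A is U^-1 *m diag_mx d *m U with          *)
(* U = spectralmx A unitary and d = spectral_diag A real                      *)
(* (orthomx_spectralP, hermitian_spectral_diag_real), and A^p is              *)
(* U^-1 *m diag_mx (d_i `^ p)_i *m U.  Only meaningful for A positive         *)
(* definite, where every d_i is > 0; p may then be any real number.           *)
Definition mxpowR (R : realType) (n : nat) (A : 'M[R[i]]_n) (p : R) :
    'M[R[i]]_n :=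
  invmx (spectralmx A)
    *m diag_mx (map_mx (fun z : R[i] => (complex.Re z `^ p)%:C)
                       (spectral_diag A))
    *m spectralmx A.

Definition warith_mean (R : realType) (n : nat) (v : R) (A B : 'M[R[i]]_n) :
    'M[R[i]]_n :=
  (1 - v)%:C *: A + v%:C *: B.

Definition arith_mean (R : realType) (n : nat) (A B : 'M[R[i]]_n) :
    'M[R[i]]_n :=
  2^-1 *: (A + B).

Definition wgeom_mean (R : realType) (n : nat) (v : R) (A B : 'M[R[i]]_n) :
    'M[R[i]]_n :=
  mxpowR A 2^-1
    *m mxpowR (mxpowR A (- 2^-1) *m B *m mxpowR A (- 2^-1)) v
    *m mxpowR A 2^-1.

(* Main.v *)
(* Congruence by V = U A^{1/2}, with U a unitary diagonalizing
   A^{-1/2} B A^{-1/2}, turns A, B and every A^{1/2} f(A^{-1/2} B A^{-1/2}) A^{1/2}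
   into 1, diag(x_i) and diag(f(x_i)), so that the inequality reduces to
     x^v <= 1 - v + v x - v (1 - v) (x - 1)^2 / (x + 1)
   for x >= 1 in case (i) and 0 < x <= 1 in case (ii).  After multiplication by
   x + 1, the difference h of the two sides satisfies h(1) = h'(1) = h''(1) = 0 and
     h'''(x) = v (1 - v) x^{v-3} ((v + 1) x - (2 - v)),
   which has the sign of x - 1 on the relevant range; the mean value theorem,
   applied three times, yields h >= 0. *)

Require Import Defs.
From mathcomp Require Import all_boot all_order all_algebra.
From mathcomp Require Import complex ring lra.
From mathcomp Require Import classical_sets reals topology normedtype derive exp.

Import Order.TTheory GRing.Theory Num.Theory.
Import numFieldNormedType.Exports.
Local Open Scope ring_scope.
Local Open Scope complex_scope.
Local Open Scope sesquilinear_scope.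

(** * The scalar inequality for real powers *)

Definition between1 {R : realType} (x c : R) : Prop := 1 <= c <= x \/ x <= c <= 1.

(** The base point 1 is where [h] and its first two derivatives vanish. Derivatives are assumed only
    at positive points, where real powers are differentiable; the segment between 1 and a positive
    [x] stays among them, on whichever side of 1 it lies. *)
Lemma MVT_from1 {R : realType} {f df : R -> R} {x : R} :
  (forall t : R, 0 < t -> is_derive t 1 f (df t)) -> 0 < x ->
  exists2 c, between1 x c & f x = f 1 + df c * (x - 1).
Proof.
move=> fdf x0.
have cf (a b : R) : 0 < a -> {within `[a, b], continuous f}%classic.
  move=> a0; apply: derivable_within_continuous => t; rewrite in_itv /= => /andP[at_ _].
  by have [] := fdf t (lt_le_trans a0 at_).
have dfi (a b : R) : 0 < a -> forall t : R, t \in `]a, b[ -> is_derive t 1 f (df t).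
  move=> a0 t; rewrite in_itv /= => /andP[at_ _]; exact/fdf/(lt_trans a0).
have [x1|/ltW x1] := leP 1 x.
  have [c cx fx] := MVT_segment x1 (dfi _ _ ltr01) (cf _ _ ltr01).
  by exists c; [left; move: cx; rewrite in_itv|rewrite -fx addrC subrK].
have [c cx fx] := MVT_segment x1 (dfi _ _ x0) (cf _ _ x0).
exists c; [by right; move: cx; rewrite in_itv|].
by rewrite -(opprB 1 x) mulrN -fx opprB addrC subrK.
Qed.

(** This shape covers [h], [h1] and [h2] below, so one computation serves all three
    differentiations. *)
Lemma is_derive_quad_powR {R : realType} (a b c d e p q x : R) : 0 < x ->
  is_derive x 1 (fun t : R => a * t ^+ 2 + b * t + c + (d * t `^ p + e * t `^ q))
    (2 * a * x + b + (d * (p * x `^ (p - 1)) + e * (q * x `^ (q - 1)))).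
Proof.
move=> x0.
have dp := is_derive1_powR p x0; have dq := is_derive1_powR q x0.
apply: is_derive_eq; rewrite /GRing.scale /=; ring.
Qed.

Lemma powR_rational_bound {R : realType} (v x : R) :
  (1 <= x /\ 2^-1 <= v <= 1) \/ (0 < x <= 1 /\ 0 <= v <= 2^-1) ->
  x `^ v <= 1 - v + v * x - v * (1 - v) * (x - 1) ^+ 2 / (x + 1).
Proof.
move=> xv.
have x0 : 0 < x by lra.
pose h (t : R) := v ^+ 2 * t ^+ 2 + (1 + 2 * v - 2 * v ^+ 2) * t + (1 - v) ^+ 2
  + (-1 * t `^ (v + 1) + -1 * t `^ v).
(* The zero coefficients here and in [h2] keep the shape of [is_derive_quad_powR]. *)
pose h1 (t : R) := 0 * t ^+ 2 + 2 * v ^+ 2 * t + (1 + 2 * v - 2 * v ^+ 2)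
  + (- (v + 1) * t `^ v + - v * t `^ (v - 1)).
pose h2 (t : R) := 0 * t ^+ 2 + 0 * t + 2 * v ^+ 2
  + (- (v + 1) * v * t `^ (v - 1) + - v * (v - 1) * t `^ (v - 2)).
pose h3 (t : R) := v * (1 - v) * t `^ (v - 3) * ((v + 1) * t - (2 - v)).
have dh (t : R) : 0 < t -> is_derive t 1 h (h1 t).
  move=> t0; have D := is_derive_quad_powR (v ^+ 2) (1 + 2 * v - 2 * v ^+ 2)
    ((1 - v) ^+ 2) (-1) (-1) (v + 1) v t t0.
  apply: (is_derive_eq D); rewrite /h1 addrK; ring.
have dh1 (t : R) : 0 < t -> is_derive t 1 h1 (h2 t).
  move=> t0; have D := is_derive_quad_powR 0 (2 * v ^+ 2)
    (1 + 2 * v - 2 * v ^+ 2) (- (v + 1)) (- v) v (v - 1) t t0.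
  apply: (is_derive_eq D); rewrite /h2 (_ : v - 1 - 1 = v - 2); ring.
have dh2 (t : R) : 0 < t -> is_derive t 1 h2 (h3 t).
  move=> t0; have D := is_derive_quad_powR 0 0 (2 * v ^+ 2)
    (- (v + 1) * v) (- v * (v - 1)) (v - 1) (v - 2) t t0.
  apply: (is_derive_eq D).
  (* Splitting the exponent [v - 2] as [v - 3 + 1] lets [powRD] expose the common factor of [h3]. *)
  rewrite /h3 (_ : v - 1 - 1 = v - 3 + 1); last by ring.
  rewrite (_ : v - 2 - 1 = v - 3); last by ring.
  rewrite powRD ?powRr1 ?ltW ?(gt_eqF t0) ?implybT//; ring.
have h_1 : h 1 = 0 by rewrite /h !powR1; ring.
have h1_1 : h1 1 = 0 by rewrite /h1 !powR1; ring.
have h2_1 : h2 1 = 0 by rewrite /h2 !powR1; ring.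
have [c1 xc1 hx] := MVT_from1 dh x0.
have c10 : 0 < c1 by case: xc1; lra.
have [c2 xc2 hc1] := MVT_from1 dh1 c10.
have c20 : 0 < c2 by case: xc2; lra.
have [c3 xc3 hc2] := MVT_from1 dh2 c20.
have h_ge0 : 0 <= h x.
  (* The three mean value steps combine into [h x = h3 c3 * (c2 - 1) * (c1 - 1) * (x - 1)]; the four
     factors are all nonnegative when [1 <= x] and all nonpositive when [x <= 1]. *)
  rewrite hx hc1 hc2 h_1 h1_1 h2_1 !add0r -mulrA /h3.
  have v1v : 0 <= v * (1 - v) by rewrite mulr_ge0; lra.
  have p0 : 0 <= c3 `^ (v - 3) by exact: powR_ge0.
  case: xv => -[xx vv].
    have c11 : 1 <= c1 by case: xc1; lra.
    have c21 : 1 <= c2 by case: xc2; lra.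
    have c31 : 1 <= c3 by case: xc3; lra.
    (* The linear factor of [h3 c3] is [(v + 1) * (c3 - 1) + (2 * v - 1)], so the position of [v]
       relative to 1/2 settles its sign. *)
    have lin : 0 <= (v + 1) * (c3 - 1) by rewrite mulr_ge0; lra.
    apply: mulr_ge0; last by apply: mulr_ge0; lra.
    by apply: mulr_ge0; [apply: mulr_ge0; [exact: mulr_ge0 | lra] | lra].
  have c11 : c1 <= 1 by case: xc1; lra.
  have c21 : c2 <= 1 by case: xc2; lra.
  have c31 : c3 <= 1 by case: xc3; lra.
  have lin : (v + 1) * (c3 - 1) <= 0 by rewrite mulr_ge0_le0; lra.
  apply: mulr_ge0; last by apply: mulr_le0; lra.
  by apply: mulr_le0; [apply: mulr_ge0_le0; [exact: mulr_ge0 | lra] | lra].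
have x10 : 0 < x + 1 by lra.
rewrite -(ler_pM2r x10) mulrBl divfK ?gt_eqF// -subr_ge0.
suff <- : h x = (1 - v + v * x) * (x + 1) - v * (1 - v) * (x - 1) ^+ 2
    - x `^ v * (x + 1) by [].
by rewrite /h powRD ?powRr1 ?(gt_eqF x0) ?implybT ?ltW//; ring.
Qed.

(** * Quadratic forms and congruence *)

Section QuadraticForm.
Context {C : numClosedFieldType}.

Lemma trmxC_mul {m n p : nat} (M : 'M[C]_(m, n)) (N : 'M[C]_(n, p)) :
  (M *m N)^t* = N^t* *m M^t*.
Proof. by rewrite trmx_mul map_mxM. Qed.

Lemma invmx_uniq {n : nat} (M N : 'M[C]_n) : M *m N = 1%:M -> invmx M = N.
Proof.
by move=> MN; have [Mu _] := mulmx1_unit MN; rewrite -(mulKmx Mu N) MN mulmx1.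
Qed.

Context {n : nat}.
Implicit Types (A B M V : 'M[C]_n) (x : 'cV[C]_n) (d : 'rV[C]_n) (f g : C -> C).

Definition qform M x : C := (x^t* *m M *m x) 0 0.
Definition psd M : Prop := forall x, 0 <= qform M x.
Definition pd M : Prop := forall x, x != 0 -> 0 < qform M x.

Lemma qform_congr M V x : qform (V^t* *m M *m V) x = qform M (V *m x).
Proof. by rewrite /qform trmxC_mul !mulmxA. Qed.

Lemma qform_adj M x : qform (M^t*) x = (qform M x)^*%R.
Proof.
transitivity (((x^t* *m M *m x)^t*) 0 0); last by rewrite 2!mxE.
by rewrite !trmxC_mul trmxCK /qform !mulmxA.
Qed.

Lemma qform_diag d x : qform (diag_mx d) x = \sum_i d 0 i * `|x i 0| ^+ 2.
Proof.
rewrite /qform -mulmxA mxE; apply: eq_bigr => i _.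
by rewrite mul_diag_mx !mxE normCK mulrCA [X in _ * X]mulrC.
Qed.

Lemma qform_diag_delta d i : qform (diag_mx d) (delta_mx i 0) = d 0 i.
Proof.
rewrite qform_diag (bigD1 i) //= big1 => [|j /negPf ji].
  by rewrite !mxE !eqxx normr1 expr1n mulr1 addr0.
by rewrite !mxE ji /= normr0 expr0n mulr0.
Qed.

Lemma psd_congr M V : psd M -> psd (V^t* *m M *m V).
Proof. by move=> M0 x; rewrite qform_congr. Qed.

Lemma psd_congr_unit M V : V \in unitmx -> psd (V^t* *m M *m V) -> psd M.
Proof.
by move=> Vu M0 x; have := M0 (invmx V *m x); rewrite qform_congr mulKVmx.
Qed.

Lemma pd_congr M V : V \in unitmx -> pd M -> pd (V^t* *m M *m V).
Proof.
move=> Vu M0 x x0; rewrite qform_congr; apply: M0.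
by apply: contra x0 => /eqP Vx0; rewrite -(mulKmx Vu x) Vx0 mulmx0.
Qed.

Lemma pd_congr_unit M V : V \in unitmx -> pd (V^t* *m M *m V) -> pd M.
Proof.
move=> Vu M0 x x0; have := M0 (invmx V *m x).
rewrite qform_congr mulKVmx //; apply.
by apply: contra x0 => /eqP Vx0; rewrite -(mulKVmx Vu x) Vx0 mulmx0.
Qed.

Lemma psd_diag d : psd (diag_mx d) <-> forall i, 0 <= d 0 i.
Proof.
split=> [d0 i|d0 x]; first by have := d0 (delta_mx i 0); rewrite qform_diag_delta.
by rewrite qform_diag sumr_ge0 // => i _; rewrite mulr_ge0 ?exprn_ge0.
Qed.

Lemma pd_diag_gt0 d i : pd (diag_mx d) -> 0 < d 0 i.
Proof.
move=> d0; have := d0 (delta_mx i 0); rewrite qform_diag_delta; apply.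
by apply/negP => /eqP/matrixP/(_ i 0)/eqP; rewrite !mxE !eqxx oner_eq0.
Qed.

Lemma pd_psd M : pd M -> psd M.
Proof.
move=> M0 x; have [->|x0] := eqVneq x 0; last exact/ltW/M0.
by rewrite /qform mulmx0 mxE.
Qed.

(** * Spectral decomposition and functional calculus *)

Lemma spectral_adj M : M \is normalmx ->
  M = (spectralmx M)^t* *m diag_mx (spectral_diag M) *m spectralmx M.
Proof.
by move=> /orthomx_spectralP; rewrite invmx_unitary ?spectral_unitarymx.
Qed.

(* M - M^t* is normal with zero quadratic form, so its eigenvalues vanish. *)
Lemma psd_adj M : psd M -> M^t* = M.
Proof.
move=> M0; pose N := M - M^t*.
have N_adj : N^t* = - N by rewrite /N raddfB /= map_mxB trmxCK opprB.
have N_normal : N \is normalmx by apply/normalmxP; rewrite N_adj mulmxN mulNmx.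
(* Nonnegative elements of [C] are real, so [M] and [M^t*] have the same quadratic form. *)
have N0 x : qform N x = 0.
  have : qform N x = qform M x - qform (M^t*) x.
    by rewrite /qform /N mulmxBr mulmxBl !mxE.
  by rewrite qform_adj geC0_conj // subrr.
have NE := spectral_adj _ N_normal.
have d0 : spectral_diag N = 0.
  apply/rowP => i; rewrite mxE -qform_diag_delta.
  rewrite -[delta_mx i 0](mulKVmx (spectral_unit N)) -qform_congr.
  by rewrite -NE N0.
by move: NE; rewrite d0 raddf0 mulmx0 mul0mx => /eqP; rewrite subr_eq0 => /eqP.
Qed.

Lemma pd_normal M : pd M -> M \is normalmx.
Proof. by move=> /pd_psd/psd_adj M_adj; apply/normalmxP; rewrite M_adj. Qed.

(** The conjugate transpose stands for the inverse of the unitary [spectralmx M], which makes this a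
    congruence of a diagonal matrix. *)
Definition mxfun f M :=
  (spectralmx M)^t* *m diag_mx (map_mx f (spectral_diag M)) *m spectralmx M.

Lemma mxfunM f g M : mxfun f M *m mxfun g M = mxfun (fun z => f z * g z) M.
Proof.
rewrite /mxfun !mulmxA mulmxtVK ?spectral_unitarymx //.
rewrite -[_ *m _ *m diag_mx _]mulmxA mulmx_diag.
by congr (_ *m diag_mx _ *m _); apply/rowP => i; rewrite !mxE.
Qed.

Lemma mxfun_adj f M : (forall z, (f z)^*%R = f z) -> (mxfun f M)^t* = mxfun f M.
Proof.
move=> f_real; rewrite !trmxC_mul trmxCK mulmxA tr_diag_mx map_diag_mx.
by congr (_ *m diag_mx _ *m _); apply/rowP => i; rewrite !mxE; exact: f_real.
Qed.

Lemma spectral_diag_gt0 M : pd M -> forall i, 0 < spectral_diag M 0 i.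
Proof.
move=> M0 i; apply: pd_diag_gt0; apply: pd_congr_unit (spectral_unit M) _.
by rewrite -spectral_adj // pd_normal.
Qed.

(** Only the values of [f] at the eigenvalues matter, and these are positive; hence power identities
    are needed for [0 < z] only. *)
Lemma mxfun_id f M : pd M -> (forall z, 0 < z -> f z = z) -> mxfun f M = M.
Proof.
move=> M0 fE; rewrite [RHS]spectral_adj ?pd_normal //.
congr (_ *m diag_mx _ *m _); apply/rowP => i.
by rewrite mxE fE // spectral_diag_gt0.
Qed.

Lemma mxfun_1 f M : pd M -> (forall z, 0 < z -> f z = 1) -> mxfun f M = 1%:M.
Proof.
move=> M0 fE; rewrite /mxfun (_ : map_mx f _ = const_mx 1).
  rewrite diag_const_mx mulmx1 -invmx_unitary ?spectral_unitarymx //.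
  by rewrite mulVmx ?spectral_unit.
by apply/rowP => i; rewrite !mxE fE // spectral_diag_gt0.
Qed.

(** * Simultaneous diagonalization and the matrix inequality *)

(** Here [r] and [s] play the square root and its inverse. The matrix [mxfun f D] is diagonalized by
    the same unitary as [D], so one [V] serves every [f]. *)
Lemma simultaneous_congr A B (r s : C -> C) :
  pd A -> pd B -> (forall z, (r z)^*%R = r z) -> (forall z, (s z)^*%R = s z) ->
  (forall z, 0 < z -> r z * r z = z) -> (forall z, 0 < z -> r z * s z = 1) ->
  exists V d,
    [/\ V \in unitmx, forall i, 0 < d 0 i,
        A = V^t* *m diag_mx (const_mx 1) *m V, B = V^t* *m diag_mx d *m V &
        forall f, mxfun r A *m mxfun f (mxfun s A *m B *m mxfun s A) *m mxfun r A
          = V^t* *m diag_mx (map_mx f d) *m V].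
Proof.
move=> A0 B0 r_real s_real rr rs.
set P := mxfun r A; set Q := mxfun s A.
have PQ : P *m Q = 1%:M by rewrite mxfunM mxfun_1.
have QP : Q *m P = 1%:M by rewrite mxfunM mxfun_1 // => z /rs; rewrite mulrC.
have PP : P *m P = A by rewrite mxfunM mxfun_id.
have P_adj : P^t* = P by exact: mxfun_adj.
have Q_adj : Q^t* = Q by exact: mxfun_adj.
clearbody P Q; set D := Q *m B *m Q.
have [Pu Qu] := mulmx1_unit PQ.
have D0 : pd D by rewrite /D -{1}Q_adj; exact: pd_congr.
have BE : B = P *m D *m P by rewrite /D !mulmxA PQ mul1mx -mulmxA QP mulmx1.
have DE := spectral_adj _ (pd_normal _ D0).
clearbody D; exists (spectralmx D *m P), (spectral_diag D); split.
- by rewrite unitmx_mul spectral_unit.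
- exact: spectral_diag_gt0.
- rewrite trmxC_mul P_adj diag_const_mx mulmx1 mulmxA mulmxKtV ?PP //.
  exact: spectral_unitarymx.
- by rewrite trmxC_mul P_adj {1}BE {1}DE !mulmxA.
by move=> f; rewrite trmxC_mul P_adj /mxfun !mulmxA.
Qed.

(** Every term becomes a congruence by the same [V] of a diagonal matrix, so the claim can be
    checked entry by entry at [z = d 0 i]. *)
Lemma mean_gap_psd A B (r s f : C -> C) (v : C)
    (ineq := fun z => f z <= 1 - v + v * z - v * (1 - v) * (z - 1) ^+ 2 / (z + 1)) :
  pd A -> pd B -> (forall z, (r z)^*%R = r z) -> (forall z, (s z)^*%R = s z) ->
  (forall z, 0 < z -> r z * r z = z) -> (forall z, 0 < z -> r z * s z = 1) ->
  (psd (B - A) /\ forall z, 1 <= z -> ineq z) \/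
  (psd (A - B) /\ forall z, 0 < z <= 1 -> ineq z) ->
  psd ((1 - v) *: A + v *: B
       - mxfun r A *m mxfun f (mxfun s A *m B *m mxfun s A) *m mxfun r A
       - (v * (1 - v) / 2) *: ((B - A) *m invmx (2^-1 *: (A + B)) *m (B - A))).
Proof.
move=> A0 B0 r_real s_real rr rs side.
have [V [d [Vu d0 AE BE GE]]] := simultaneous_congr _ _ _ _ A0 B0 r_real s_real rr rs.
rewrite GE; pose K (e : 'rV[C]_n) := V^t* *m diag_mx e *m V.
have KD e e' : K e + K e' = K (e + e') by rewrite /K raddfD mulmxDr mulmxDl.
have KN e : - K e = K (- e) by rewrite /K raddfN mulmxN mulNmx.
have KZ c e : c *: K e = K (c *: e) by rewrite /K linearZ -scalemxAr -scalemxAl.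
rewrite -/(K _) in AE; rewrite -/(K _) in BE; rewrite -/(K _).
have d_ineq i : ineq (d 0 i).
  (* Cancelling [V] in the order relation between [A] and [B] tells on which side of 1 each [d 0 i]
     lies. *)
  case: side; rewrite AE BE KN KD => -[/(psd_congr_unit _ _ Vu)/psd_diag/(_ i)];
    by rewrite !mxE subr_ge0 => di; apply; rewrite // d0.
(* Entrywise inverse of [(1 + d) / 2], the diagonal form of the arithmetic mean. *)
pose m : 'rV[C]_n := \row_i (2 / (d 0 i + 1)).
have V'u : V^t* \in unitmx by rewrite map_unitmx unitmx_tr.
have invE : invmx (2^-1 *: (A + B)) = invmx V *m diag_mx m *m invmx (V^t*).
  apply: invmx_uniq; rewrite AE BE KD KZ /K !mulmxA mulmxK //.
  rewrite -[_ *m diag_mx _ *m diag_mx _]mulmxA mulmx_diag.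
  rewrite (_ : \row_i _ = const_mx 1) ?diag_const_mx ?mulmx1 ?mulmxV //.
  apply/rowP => i; rewrite !mxE.
  have di0 : d 0 i + 1 != 0 by rewrite gt_eqF // addr_gt0.
  by rewrite [1 + _]addrC; field.
(* The inner factors [V] and [V^t*] cancel against the inverse; the 2 in each entry then absorbs the
   1/2 in [v * (1 - v) / 2]. *)
have gapE : (B - A) *m invmx (2^-1 *: (A + B)) *m (B - A)
    = K (\row_i (2 * (d 0 i - 1) ^+ 2 / (d 0 i + 1))).
  rewrite invE AE BE KN KD /K !mulmxA mulmxK // mulmxKV //.
  rewrite -[_ *m diag_mx _ *m diag_mx m]mulmxA mulmx_diag.
  rewrite -[_ *m diag_mx _ *m diag_mx _]mulmxA mulmx_diag.
  congr (_ *m diag_mx _ *m _); apply/rowP => i; rewrite !mxE; ring.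
rewrite gapE {1}AE {1}BE !(KZ, KN, KD); apply/psd_congr/psd_diag => i.
have di := d_ineq i; rewrite /ineq -subr_ge0 in di.
rewrite !mxE; apply: (le_trans di); rewrite le_eqVlt; apply/orP; left; apply/eqP.
have di0 : d 0 i + 1 != 0 by rewrite gt_eqF // addr_gt0.
by field.
Qed.

End QuadraticForm.

(** * Specialization to powers over [R[i]] *)

Theorem corollary2p5 (R : realType) (n : nat) (A B : 'M[R[i]]_n) (v : R)
    (hA : posdef A) (hB : posdef B)
    (hv : (loewner_le A B /\ 2^-1 <= v <= 1) \/
          (loewner_le B A /\ 0 <= v <= 2^-1)) :
  loewner_le
    ((v * (1 - v) / 2)%:C *: ((B - A) *m invmx (arith_mean A B) *m (B - A)))
    (warith_mean v A B - wgeom_mean v A B).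
Proof.
have cdotE (M : 'M[R[i]]_n) x : cdot (M *m x) x = qform M x.
  by rewrite /cdot /qform mulmxA.
have pdP (M : 'M[R[i]]_n) : posdef M -> pd M.
  by move=> M0 x x0; rewrite -cdotE; exact: M0.
have psdP (M : 'M[R[i]]_n) : possemidef M -> psd M by move=> M0 x; rewrite -cdotE.
(* This is the function inside [mxpowR]; taking the real part makes it real-valued at every [z], as
   [mxfun_adj] requires. *)
pose pow (p : R) (z : R[i]) := (complex.Re z `^ p)%:C.
have powE p (M : 'M[R[i]]_n) : mxpowR M p = mxfun (pow p) M.
  by rewrite /mxpowR invmx_unitary // spectral_unitarymx.
have pow_real p z : (pow p z)^*%R = pow p z by exact: conjc_real.
have Re_gt0 (z : R[i]) : 0 < z -> 0 < complex.Re z by rewrite ltcE => /andP[].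
have powD p q z : 0 < z -> pow p z * pow q z = pow (p + q) z.
  move=> z0; rewrite /pow powRD ?(gt_eqF (Re_gt0 z z0)) ?implybT // rmorphM.
  reflexivity.
have pow_half z : 0 < z -> pow 2^-1 z * pow 2^-1 z = z.
  move=> z0; rewrite powD // -[2^-1]div1r -splitr /pow powRr1 ?ltW ?Re_gt0 //.
  exact/RRe_real/gtr0_real.
have pow_opp z : 0 < z -> pow 2^-1 z * pow (- 2^-1) z = 1.
  by move=> z0; rewrite powD // subrr /pow powRr0.
have pow_bound (z : R[i]) :
    (1 <= complex.Re z /\ 2^-1 <= v <= 1) \/
    (0 < complex.Re z <= 1 /\ 0 <= v <= 2^-1) -> 0 <= z ->
  pow v z <= 1 - v%:C + v%:C * z - v%:C * (1 - v%:C) * (z - 1) ^+ 2 / (z + 1).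
  (* Since [0 <= z] makes [z] equal to its real part, the real inequality transfers through the
     embedding of [R]. *)
  move=> /powR_rational_bound bnd /ger0_real/RRe_real zE.
  rewrite -zE; move: bnd; rewrite -lecR.
  by rewrite !(rmorphB, rmorphD, rmorphM, fmorphV, rmorphXn, rmorph1).
have half : (v * (1 - v) / 2)%:C = v%:C * (1 - v%:C) / 2 :> R[i].
  by rewrite !(rmorphB, rmorphM, fmorphV, rmorph_nat, rmorph1).
suff gap : psd ((1 - v%:C) *: A + v%:C *: B - wgeom_mean v A B
    - (v%:C * (1 - v%:C) / 2) *: ((B - A) *m invmx (2^-1 *: (A + B)) *m (B - A))).
  move=> x; rewrite cdotE half /warith_mean rmorphB; exact: gap.
rewrite /wgeom_mean !powE.
apply: (mean_gap_psd _ _ (pow 2^-1) (pow (- 2^-1)) (pow v) v%:C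
  (pdP _ hA) (pdP _ hB) (pow_real _) (pow_real _) pow_half pow_opp).
case: hv => -[/psdP le_AB v01]; [left|right]; split=> // z.
  move=> z1; apply: pow_bound; last exact: le_trans z1.
  by left; split=> //; move: z1; rewrite lecE => /andP[].
move=> /andP[z0 z1]; apply: pow_bound; last exact: ltW.
by right; split=> //; rewrite Re_gt0 //=; move: z1; rewrite lecE => /andP[].
Qed.
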